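(* Let $G$ be a symmetry group of the discrete Lagrange--Poincaré system $\mathcal M=(E,L_d,\mathcal P)$ over a fiber bundle $\phi:E\to M$, let $\mathcal A_d$ be a discrete connection on the principal $G$-bundle $\pi^{M,G}:M\to M/G$, and let $\mathcal M/(G,\mathcal A_d)=(\tilde G_E,\check L_d,\check{\mathcal P})$ be the corresponding reduced system. Let $(\epsilon_\cdot,m_\cdot)=((\epsilon_0,m_1),\ldots,(\epsilon_{N-1},m_N))$, $N\ge 2$, be a discrete path in $C'(E)$ and define a discrete path $(v_\cdot,r_\cdot)$ in $C'(\tilde G_E)$ by $(v_k,r_{k+1}):=\Upsilon_{\mathcal A_d}(\epsilon_k,m_{k+1})$ for $k=0,\ldots,N-1$. Then $(\epsilon_\cdot,m_\cdot)$ is a trajectory of $\mathcal M$ if and only if $(v_\cdot,r_\cdot)$ is a trajectory of $\mathcal M/(G,\mathcal A_d)$.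
   Context: Notation. $p_j$ is the projection of a Cartesian product on its $j$-th factor; $D_j$ is the restriction of the differential to the $j$-th factor of a product. A fiber bundle $(E,M,\phi,F)$ is a smooth map $\phi:E\to M$ of manifolds such that every $m\in M$ has an open neighborhood $U$ and a diffeomorphism $\Phi_U:\phi^{-1}(U)\to U\times F$ with $p_1\circ\Phi_U=\phi$ (a trivializing chart). For a left action $l^X$ of a Lie group $G$ on $X$, $\pi^{X,G}:X\to X/G$ is the quotient map. A principal $G$-bundle is a surjective submersion whose total space carries a smooth free left $G$-action with orbits equal to the fibers. Group action on a fiber bundle. $G$ acts on $(E,M,\phi,F)$ if there are smooth free left actions $l^E,l^M$ and a smooth right action $r^F$ on $F$ such that (1) $\pi^{M,G}:M\to M/G$ is a principal $G$-bundle; (2) $\phi$ is $G$-equivariant; (3) every $m\in M$ lies in a $G$-invariant open $U$ with a trivializing chart $\Phi_U$ that is $G$-equivariant for $l^{U\times F}_g(m,f)=(l^M_g(m),r^F_{g^{-1}}(f))$ on $U\times F$. DLPS. For a fiber bundle $\phi:E\to M$ put $C'(E)=E\times M$ and $C''(E)=\{((\epsilon_0,m_1),(\epsilon_1,m_2))\in C'(E)^2: m_1=\phi(\epsilon_1)\}$. A discrete Lagrange--Poincaré system (DLPS) over $E$ is $\mathcal M=(E,L_d,\mathcal P)$ with $L_d:C'(E)\to\mathbb R$ smooth and $\mathcal P$ an infinitesimal variation chaining map: a smooth family of linear maps $\mathcal P((\epsilon_0,m_1),(\epsilon_1,m_2)):T_{\epsilon_1}E\to\ker d\phi(\epsilon_0)\subset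 T_{\epsilon_0}E$ indexed by $C''(E)$ (a vector bundle homomorphism). Trajectories. A discrete path in $C'(E)$ is $((\epsilon_0,m_1),\ldots,(\epsilon_{N-1},m_N))$ with consecutive pairs in $C''(E)$. An infinitesimal variation with fixed endpoints on it is a family $(\delta\epsilon_k,\delta m_{k+1})\in T_{(\epsilon_k,m_{k+1})}C'(E)$, $k=0,\dots,N-1$, with $\delta m_k=d\phi(\epsilon_k)(\delta\epsilon_k)$ for $1\le k\le N-1$, $\delta m_N=0$, and for which there are arbitrary vectors $\widetilde{\delta\epsilon_k}\in T_{\epsilon_k}E$ ($1\le k\le N-1$) with $\delta\epsilon_{N-1}=\widetilde{\delta\epsilon_{N-1}}$, $\delta\epsilon_k=\widetilde{\delta\epsilon_k}+\mathcal P((\epsilon_k,m_{k+1}),(\epsilon_{k+1},m_{k+2}))(\widetilde{\delta\epsilon_{k+1}})$ for $1\le k\le N-2$, and $\delta\epsilon_0=\mathcal P((\epsilon_0,m_1),(\epsilon_1,m_2))(\widetilde{\delta\epsilon_1})$. With $S_d(\epsilon_\cdot,m_\cdot)=\sum_{k=0}^{N-1}L_d(\epsilon_k,m_{k+1})$, the path is a trajectory if $dS_d(\epsilon_\cdot,m_\cdot)(\delta\epsilon_\cdot,\delta m_\cdot)=0$ for all infinitesimal variations with fixed endpoints. Symmetry group. $G$ is a symmetry group of $\mathcal M=(E,L_d,\mathcal P)$ if $G$ acts on the fiber bundle $E$, $L_d$ is invariant under $l^{C'(E)}_g(\epsilon_0,m_1)=(l^E_g(\epsilon_0),l^M_g(m_1))$,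 and $\mathcal P$ is equivariant: $\mathcal P(l^{C'(E)}_g(\epsilon_0,m_1),l^{C'(E)}_g(\epsilon_1,m_2))(dl^E_g(\delta\epsilon_1))=dl^E_g(\mathcal P((\epsilon_0,m_1),(\epsilon_1,m_2))(\delta\epsilon_1))$ for all $g\in G$. Discrete connections. A discrete connection $\mathcal A_d$ on a principal $G$-bundle $\pi^{M,G}:M\to M/G$ is given by a submanifold $Hor\subset M\times M$, invariant under the diagonal $G$-action and containing the diagonal, such that $(id_M\times\pi^{M,G})|_{Hor}:Hor\to M\times(M/G)$ is an injective local diffeomorphism. Convention: it is treated as globally defined (this map is onto), so that for all $m_0,m_1$ there is a unique $g=:\mathcal A_d(m_0,m_1)\in G$ with $(m_0,l^M_{g^{-1}}(m_1))\in Hor$; the function $\mathcal A_d:M\times M\to G$ is smooth. Reduction. $\tilde G_E:=(E\times G)/G$ is the quotient by $g\cdot(\epsilon,w)=(l^E_g(\epsilon),gwg^{-1})$; it is a fiber bundle over $M/G$ with projection $p^{M/G}(\pi^{E\times G,G}(\epsilon,w))=\pi^{M,G}(\phi(\epsilon))$ and fiber $F\times G$, so $C'(\tilde G_E)=\tilde G_E\times(M/G)$. Given $\mathcal A_d$, let $\Upsilon_{\mathcal A_d}:C'(E)\to C'(\tilde G_E)$, $\Upsilon_{\mathcal A_d}(\epsilon,m)=(\pi^{E\times G,G}(\epsilon,\mathcal A_d(\phi(\epsilon),m)),\pi^{M,G}(m))$. The reduced DLPS $\mathcal M/(G,\mathcal A_d)=(\tilde G_E,\check L_d,\check{\mathcal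 P})$ is defined by $\check L_d\circ\Upsilon_{\mathcal A_d}=L_d$ and $\check{\mathcal P}((v_0,r_1),(v_1,r_2))(\delta v_1)=D_1(p_1\circ\Upsilon_{\mathcal A_d})(\epsilon_0,m_1)(\mathcal P((\epsilon_0,m_1),(\epsilon_1,m_2))(\delta\epsilon_1))+D_2(p_1\circ\Upsilon_{\mathcal A_d})(\epsilon_0,m_1)(d\phi(\epsilon_1)(\delta\epsilon_1))$, where $((\epsilon_0,m_1),(\epsilon_1,m_2))\in C''(E)$ is any element with $\Upsilon_{\mathcal A_d}(\epsilon_0,m_1)=(v_0,r_1)$, $\Upsilon_{\mathcal A_d}(\epsilon_1,m_2)=(v_1,r_2)$ and $\delta\epsilon_1$ is the unique vector with $D_1(p_1\circ\Upsilon_{\mathcal A_d})(\epsilon_1,m_2)(\delta\epsilon_1)=\delta v_1$ (this is well defined). *)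

(* Defs.v *)
From HB Require Import structures.
From mathcomp Require Import all_boot all_order all_algebra.
From mathcomp Require Import all_classical all_reals topology normedtype derive.

Set Implicit Arguments.
Unset Strict Implicit.
Unset Printing Implicit Defensive.

Import Order.TTheory GRing.Theory Num.Theory.
Import numFieldNormedType.Exports.
Local Open Scope classical_set_scope.
Local Open Scope ring_scope.

#[short(type="finNormedModType")]
HB.structure Definition FinNormedModule (R : realType) :=
  {V of Vector R V & NormedModule R V}.

HB.instance Definition _ (R : realType) (U V : finNormedModType R) :=
  Vector.on (U * V)%type.

(* [Ck k U f] is only meant for an open [U], where the witness [Df] is forced
   to be the differential of [f]. *)
Fixpoint Ck (R : realType) (V W : normedModType R) (k : nat) (U : set V)
    (f : V -> W) : Prop :=
  if k is k'.+1 then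
    exists Df : V -> V -> W,
      (forall u, U u -> is_diff u f (Df u)) /\
      (forall v, Ck k' U (fun u => Df u v))
  else forall u, U u -> {for u, continuous f}.

Definition Cinfty (R : realType) (V W : normedModType R) (U : set V)
  (f : V -> W) : Prop := forall k, Ck k U f.

(* A homeomorphism between an open set of [T] and an open set of [V]; the total
   functions [cmap] and [cinv] are irrelevant outside [cdom] and [cimg]. *)
Record chart (R : realType) (T : topologicalType) (V : normedModType R) :=
  Chart {
  cdom : set T;
  cimg : set V;
  cmap : T -> V;
  cinv : V -> T;
  open_cdom : open cdom;
  open_cimg : open cimg;
  cmap_img : forall x, cdom x -> cimg (cmap x);
  cinv_dom : forall u, cimg u -> cdom (cinv u);
  cmapK : forall x, cdom x -> cinv (cmap x) = x;
  cinvK : forall u, cimg u -> cmap (cinv u) = u;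
  cmap_cont : forall x, cdom x -> {for x, continuous cmap};
  cinv_cont : forall u, cimg u -> {for u, continuous cinv} }.

Definition smooth_transition (R : realType) (T : topologicalType)
    (V : normedModType R) (c d : chart T V) : Prop :=
  Cinfty (cimg c `&` cinv c @^-1` cdom d) (cmap d \o cinv c).

(* [chart_at x] is a preferred chart around [x]. It only serves to identify the
   tangent space at [x] with [model]; smoothness refers to the whole atlas. *)
HB.mixin Record isManifold (R : realType) T & Topological T := {
  model : finNormedModType R;
  atlas : set (chart T model);
  chart_at : T -> chart T model;
  atlas_chart_at : forall x, atlas (chart_at x);
  mem_chart_at : forall x, cdom (chart_at x) x;
  atlas_smooth : forall c d, atlas c -> atlas d -> smooth_transition c d;
  manifold_hausdorff : hausdorff_space T;
  manifold_second_countable : @second_countable T }.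

#[short(type="manifoldType")]
HB.structure Definition Manifold (R : realType) :=
  {T of Topological T & isManifold R T}.

Arguments model {R} s : rename.
Arguments atlas {R} s : rename.

Section ProductManifold.
Variable R : realType.

Lemma pair_cont (S T S' T' : topologicalType) (f : S -> S') (g : T -> T')
    (z : S * T) :
  {for z.1, continuous f} -> {for z.2, continuous g} ->
  {for z, continuous (fun p : S * T => (f p.1, g p.2))}.
Proof.
move=> fu gv.
have h1 : (fun p : S * T => f p.1) @ z --> f z.1.
  apply: (cvg_comp (@fst S T) f _ fu).
  exact: (@cvg_fst _ _ (nbhs z.1) (nbhs z.2)).
have h2 : (fun p : S * T => g p.2) @ z --> g z.2.
  apply: (cvg_comp (@snd S T) g _ gv).
  exact: (@cvg_snd _ _ (nbhs z.1) (nbhs z.2)).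
exact: (cvg_pair h1 h2).
Qed.

Lemma open_setX (S T : topologicalType) (A : set S) (B : set T) :
  open A -> open B -> open (A `*` B).
Proof.
rewrite !openE => oA oB [x y] [/= /oA Ax /oB By].
by exists (A, B).
Qed.

Lemma Ck_pair (V1 V2 W1 W2 : normedModType R) k (A : set V1) (B : set V2)
    (f : V1 -> W1) (g : V2 -> W2) :
  Ck k A f -> Ck k B g ->
  Ck k (A `*` B) (fun p : V1 * V2 => (f p.1, g p.2)).
Proof.
elim: k f g => [|k IH] f g /=.
  by move=> fA gB z [/fA fu /gB gv]; exact: pair_cont.
move=> [Df [fA DfA]] [Dg [gB DgB]].
exists (fun p v => (Df p.1 v.1, Dg p.2 v.2)); split; last first.
  by move=> v; exact: IH (DfA v.1) (DgB v.2).
move=> [u v] [/= /fA fu /gB gv].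
have fst_cont : continuous (fst : V1 * V2 -> V1).
  by move=> z; exact: (@cvg_fst _ _ (nbhs z.1) (nbhs z.2)).
have snd_cont : continuous (snd : V1 * V2 -> V2).
  by move=> z; exact: (@cvg_snd _ _ (nbhs z.1) (nbhs z.2)).
have d1 : is_diff ((u, v) : V1 * V2) (fst : V1 * V2 -> V1) fst.
  by apply: DiffDef; [exact: linear_differentiable | rewrite diff_lin].
have d2 : is_diff ((u, v) : V1 * V2) (snd : V1 * V2 -> V2) snd.
  by apply: DiffDef; [exact: linear_differentiable | rewrite diff_lin].
have h1 := @is_diff_comp _ _ _ _ _ _ _ _ _ d1 fu.
have h2 := @is_diff_comp _ _ _ _ _ _ _ _ _ d2 gv.
exact: is_diff_pair h1 h2.
Qed.

Section ProdChart.
Variables (X Y : topologicalType) (V W : finNormedModType R).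
Variables (c : chart X V) (d : chart Y W).

Let pdom := cdom c `*` cdom d.
Let pimg := cimg c `*` cimg d.
Let pmap (z : X * Y) : V * W := (cmap c z.1, cmap d z.2).
Let pinv (u : V * W) : X * Y := (cinv c u.1, cinv d u.2).

Let open_pdom : open pdom.
Proof. by apply: open_setX; exact: open_cdom. Qed.
Let open_pimg : open pimg.
Proof. by apply: open_setX; exact: open_cimg. Qed.
Let pmap_img z : pdom z -> pimg (pmap z).
Proof. by case=> ? ?; split; exact: cmap_img. Qed.
Let pinv_dom u : pimg u -> pdom (pinv u).
Proof. by case=> ? ?; split; exact: cinv_dom. Qed.
Let pmapK z : pdom z -> pinv (pmap z) = z.
Proof. by case: z => x y [/= ? ?]; rewrite /pinv /= !cmapK. Qed.
Let pinvK u : pimg u -> pmap (pinv u) = u.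
Proof. by case: u => x y [/= ? ?]; rewrite /pmap /= !cinvK. Qed.
Let pmap_cont z : pdom z -> {for z, continuous pmap}.
Proof. by case=> ? ?; apply: pair_cont; exact: cmap_cont. Qed.
Let pinv_cont u : pimg u -> {for u, continuous pinv}.
Proof. by case=> ? ?; apply: pair_cont; exact: cinv_cont. Qed.

Definition prod_chart : chart (X * Y)%type (V * W)%type :=
  Chart open_pdom open_pimg pmap_img pinv_dom pmapK pinvK pmap_cont pinv_cont.

End ProdChart.

Variables X Y : manifoldType R.

Definition prod_atlas : set (chart (X * Y)%type (model X * model Y)%type) :=
  [set e | exists c d, [/\ atlas X c, atlas Y d & e = prod_chart c d]].

Definition prod_chart_at (z : X * Y) := prod_chart (chart_at z.1) (chart_at z.2).

Lemma prod_atlas_chart_at z : prod_atlas (prod_chart_at z).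
Proof.
by exists (chart_at z.1), (chart_at z.2); split=> //; exact: atlas_chart_at.
Qed.

Lemma prod_mem_chart_at z : cdom (prod_chart_at z) z.
Proof. by split; exact: mem_chart_at. Qed.

Lemma prod_atlas_smooth c d :
  prod_atlas c -> prod_atlas d -> smooth_transition c d.
Proof.
move=> [c1 [c2 [ac1 ac2 ->]]] [d1 [d2 [ad1 ad2 ->]]] k.
rewrite (_ : _ `&` _ = (cimg c1 `&` cinv c1 @^-1` cdom d1) `*`
                       (cimg c2 `&` cinv c2 @^-1` cdom d2)); last first.
  by apply/seteqP; split=> z /=; rewrite /setX /=; move=> [[? ?] [? ?]].
have h := Ck_pair (atlas_smooth _ _ ac1 ad1 k) (atlas_smooth _ _ ac2 ad2 k).
exact: h.
Qed.

Lemma prod_hausdorff : hausdorff_space (X * Y)%type.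
Proof.
move=> [x y] [x' y'] h; congr pair.
  apply: (@manifold_hausdorff R X) => A B xA x'B.
  have hA : nbhs (x, y) (A `*` setT).
    by exists (A, setT) => //; split=> //=; exact: filterT.
  have hB : nbhs (x', y') (B `*` setT).
    by exists (B, setT) => //; split=> //=; exact: filterT.
  by have [[u v] [[/= ? _] [/= ? _]]] := h _ _ hA hB; exists u.
apply: (@manifold_hausdorff R Y) => A B yA y'B.
have hA : nbhs (x, y) (setT `*` A).
  by exists (setT, A) => //; split=> //=; exact: filterT.
have hB : nbhs (x', y') (setT `*` B).
  by exists (setT, B) => //; split=> //=; exact: filterT.
by have [[u v] [[/= _ ?] [/= _ ?]]] := h _ _ hA hB; exists v.
Qed.

Lemma prod_second_countable : @second_countable (X * Y)%type.
Proof.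
have [A cA [Ao Ab]] := @manifold_second_countable R X.
have [B cB [Bo Bb]] := @manifold_second_countable R Y.
exists ((fun p => p.1 `*` p.2) @` (A `*` B)).
  exact: (sub_countable (card_image_le _ _) (countableX cA cB)).
split=> [_ [[U V] [/= /Ao ? /Bo ?] <-]|[x y] N]; first exact: open_setX.
move=> [[P Q] /= [/Ab [U [AU Ux] UP] /Bb [V [BV Vy] VQ]] PQ].
exists (U `*` V); first by split=> //; exists (U, V).
by move=> z [/UP ? /VQ ?]; exact: PQ.
Qed.

HB.instance Definition _ := isManifold.Build R (X * Y)%type
  prod_atlas_chart_at prod_mem_chart_at prod_atlas_smooth
  prod_hausdorff prod_second_countable.

End ProductManifold.

Section SmoothMaps.
Variable R : realType.

Definition tangent (X : manifoldType R) (x : X) : finNormedModType R := model X.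

(* In [smooth_on] and [vsmooth_on] the set [A] is meant to be open. *)
Definition smooth_on (X Y : manifoldType R) (A : set X) (f : X -> Y) : Prop :=
  (forall x, A x -> {for x, continuous f}) /\
  forall c d, atlas X c -> atlas Y d ->
    Cinfty (cimg c `&` cinv c @^-1` (A `&` f @^-1` cdom d))
           (cmap d \o f \o cinv c).

Definition smooth (X Y : manifoldType R) (f : X -> Y) : Prop :=
  smooth_on setT f.

Definition vsmooth_on (X : manifoldType R) (V : normedModType R) (A : set X)
    (f : X -> V) : Prop :=
  forall c, atlas X c -> Cinfty (cimg c `&` cinv c @^-1` A) (f \o cinv c).

Definition vsmooth (X : manifoldType R) (V : normedModType R) (f : X -> V) :
  Prop := vsmooth_on setT f.

(* Smoothness on an arbitrary subset: local extendability to smooth maps. On an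
   embedded submanifold this is smoothness for the submanifold structure. *)
Definition vsmooth_within (X : manifoldType R) (V : normedModType R)
    (A : set X) (f : X -> V) : Prop :=
  forall x, A x -> exists U (g : X -> V),
    [/\ open U, U x, vsmooth_on U g & forall y, A y -> U y -> f y = g y].

Definition mdiff (X Y : manifoldType R) (f : X -> Y) (x : X) :
    {linear tangent x -> tangent (f x)} :=
  'd (cmap (chart_at (f x)) \o f \o cinv (chart_at x)) (cmap (chart_at x) x).

Definition vdiff (X : manifoldType R) (V : normedModType R) (f : X -> V)
    (x : X) : {linear tangent x -> V} :=
  'd (f \o cinv (chart_at x)) (cmap (chart_at x) x).

(* Tangent vectors at [x] read in an arbitrary chart [c] around [x], and back. *)
Definition to_chart (X : manifoldType R) (c : chart X (model X)) (x : X) :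
    {linear tangent x -> model X} :=
  'd (cmap c \o cinv (chart_at x)) (cmap (chart_at x) x).

Definition of_chart (X : manifoldType R) (c : chart X (model X)) (x : X) :
    {linear model X -> tangent x} :=
  'd (cmap (chart_at x) \o cinv c) (cmap c x).

Definition mdiff1 (X Y Z : manifoldType R) (f : X * Y -> Z) (z : X * Y)
    (u : tangent z.1) : tangent (f z) :=
  mdiff f z (u, 0 : tangent z.2).

Definition mdiff2 (X Y Z : manifoldType R) (f : X * Y -> Z) (z : X * Y)
    (v : tangent z.2) : tangent (f z) :=
  mdiff f z (0 : tangent z.1, v).

Definition diffeo_on (X Y : manifoldType R) (A : set X) (B : set Y)
    (f : X -> Y) : Prop :=
  exists g : Y -> X,
    [/\ smooth_on A f, smooth_on B g,
        forall x, A x -> B (f x) /\ g (f x) = x &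
        forall y, B y -> A (g y) /\ f (g y) = y].

Definition maximal_atlas (X : manifoldType R) : set (chart X (model X)) :=
  [set c | forall d, atlas X d -> smooth_transition c d /\ smooth_transition d c].

(* Embedded submanifolds, by slice charts. *)
Definition submanifold (X : manifoldType R) (S : set X) : Prop :=
  forall x, S x -> exists (c : chart X (model X)) (W : {vspace model X}),
    [/\ maximal_atlas c, cdom c x &
        forall y, cdom c y -> S y <-> cmap c y \in W].

(* [f] restricted to the embedded submanifold [S] is a local diffeomorphism;
   maps into [S] are smooth iff they are smooth as maps into [X]. *)
Definition local_diffeo_from (X Y : manifoldType R) (S : set X) (f : X -> Y) :
    Prop :=
  forall x, S x -> exists (U : set X) (V : set Y) (g : Y -> X),
    [/\ [/\ open U, U x & open V], smooth_on U f, smooth_on V g,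
        forall z, S z -> U z -> V (f z) /\ g (f z) = z &
        forall y, V y -> [/\ S (g y), U (g y) & f (g y) = y]].

End SmoothMaps.

Section Powers.
Variable R : realType.

(* [power X n] is the manifold $X^{n+1}$. *)
Fixpoint power (X : manifoldType R) (n : nat) : manifoldType R :=
  if n is n'.+1 then (X * power X n')%type else X.

Fixpoint coord (X : manifoldType R) (n : nat) : power X n -> nat -> X :=
  if n is n'.+1 then
    fun p k => if k is k'.+1 then coord p.2 k' else p.1
  else fun p _ => p.

Fixpoint point (X : manifoldType R) (n : nat) (x : nat -> X) : power X n :=
  if n is n'.+1 then (x 0%N, point n' (fun k => x k.+1)) else x 0%N.

Fixpoint tpoint (X : manifoldType R) (n : nat) :
    forall x : nat -> X, (forall k, tangent (x k)) -> tangent (point n x) :=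
  if n is n'.+1 then
    fun x v => (v 0%N, tpoint n' (fun k => v k.+1))
  else fun x v => v 0%N.

End Powers.

HB.mixin Record isLieGroup (R : realType) G & Manifold R G & Group G := {
  mulg_smooth : smooth (fun p : G * G => (p.1 * p.2)%g);
  invg_smooth : smooth (fun g : G => g^-1%g) }.

#[short(type="lieGroupType")]
HB.structure Definition LieGroup (R : realType) :=
  {G of Manifold R G & Group G & isLieGroup R G}.

Section Actions.
Variables (R : realType) (G : lieGroupType R).

Record left_action (X : manifoldType R) (l : G -> X -> X) : Prop := {
  left_action1 : forall x, l 1%g x = x;
  left_actionM : forall g h x, l (g * h)%g x = l g (l h x);
  left_action_smooth : smooth (fun p : G * X => l p.1 p.2) }.

(* A right action is written [r g x], the group element first. *)
Record right_action (X : manifoldType R) (r : G -> X -> X) : Prop := {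
  right_action1 : forall x, r 1%g x = x;
  right_actionM : forall g h x, r (g * h)%g x = r h (r g x);
  right_action_smooth : smooth (fun p : G * X => r p.1 p.2) }.

Definition free_action (X : Type) (l : G -> X -> X) : Prop :=
  forall g x, l g x = x -> g = 1%g.

(* The quotient manifold $X/G$ is any manifold [B] with a surjective submersion
   [pi] whose fibers are the orbits; this determines [B] and [pi] up to a
   unique diffeomorphism. *)
Record quotient_map (X B : manifoldType R) (l : G -> X -> X) (pi : X -> B) :
    Prop := {
  quotient_smooth : smooth pi;
  quotient_surj : forall b, exists x, pi x = b;
  quotient_submersion : forall x (v : tangent (pi x)),
    exists u : tangent x, mdiff pi x u = v;
  quotient_fiber : forall x y, pi x = pi y <-> exists g, y = l g x }.

Record principal_bundle (X B : manifoldType R) (l : G -> X -> X)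
    (pi : X -> B) : Prop := {
  principal_action : left_action l;
  principal_free : free_action l;
  principal_quotient : quotient_map l pi }.

End Actions.

Section FiberBundles.
Variable R : realType.

Definition trivializing_chart (E M F : manifoldType R) (phi : E -> M)
    (U : set M) (Phi : E -> M * F) : Prop :=
  diffeo_on (phi @^-1` U) (U `*` setT) Phi /\
  forall e, U (phi e) -> (Phi e).1 = phi e.

Record fiber_bundle (E M F : manifoldType R) := FiberBundle {
  bundle_proj :> E -> M;
  bundle_smooth : smooth bundle_proj;
  bundle_trivial : forall m, exists (U : set M) (Phi : E -> M * F),
    [/\ open U, U m & trivializing_chart bundle_proj U Phi] }.

Record bundle_action (G : lieGroupType R) (E M F B : manifoldType R)
    (phi : fiber_bundle E M F) (lE : G -> E -> E) (lM : G -> M -> M)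
    (rF : G -> F -> F) (piM : M -> B) : Prop := {
  bundle_actionE : left_action lE;
  bundle_freeE : free_action lE;
  bundle_actionM : left_action lM;
  bundle_freeM : free_action lM;
  bundle_actionF : right_action rF;
  bundle_principal : principal_bundle lM piM;
  bundle_equivariant : forall g e, phi (lE g e) = lM g (phi e);
  bundle_equivariant_chart : forall m, exists (U : set M) (Phi : E -> M * F),
    [/\ open U, U m, forall g m', U m' -> U (lM g m'),
        trivializing_chart phi U Phi &
        forall g e, U (phi e) ->
          Phi (lE g e) = (lM g (Phi e).1, rF g^-1%g (Phi e).2)] }.

End FiberBundles.

Section DLPS.
Variable R : realType.

(* $C'(E)$ is the manifold [E * M]. *)
Definition composable (E M F : manifoldType R) (phi : fiber_bundle E M F) :
    set ((E * M) * (E * M)) :=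
  [set z | z.1.2 = phi z.2.1].

(* Only the values of [chaining] at pairs in [composable phi], that is, in
   $C''(E)$, matter. It is smooth in the sense that, read in charts of [E]
   around $\epsilon_0$ and $\epsilon_1$, it sends constant vectors [w] to smooth
   functions, i.e., that its matrix entries are smooth. *)
Record dlps (E M F : manifoldType R) (phi : fiber_bundle E M F) := DLPS {
  lagrangian : E * M -> R;
  lagrangian_smooth : vsmooth lagrangian;
  chaining : forall x y : E * M, {linear tangent y.1 -> tangent x.1};
  chaining_vertical : forall x y, composable phi (x, y) ->
    forall u, mdiff phi x.1 (chaining x y u) = 0;
  chaining_smooth : forall c0 c1, atlas E c0 -> atlas E c1 ->
    forall w : model E,
      vsmooth_within
        (composable phi `&` [set z | cdom c0 z.1.1 /\ cdom c1 z.2.1])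
        (fun z : (E * M) * (E * M) =>
           to_chart c0 z.1.1 (chaining z.1 z.2 (of_chart c1 z.2.1 w))) }.

Variables (E M F : manifoldType R) (phi : fiber_bundle E M F) (S : dlps phi).

(* A path $((\epsilon_0,m_1),\ldots,(\epsilon_{N-1},m_N))$ is a sequence [x]
   with [x k] $=(\epsilon_k,m_{k+1})$ for [k < N]; the other terms of [x] are
   irrelevant. Variations are indexed likewise. *)
Definition discrete_path (N : nat) (x : nat -> E * M) : Prop :=
  forall k, (k.+1 < N)%N -> composable phi (x k, x k.+1).

Definition fixed_endpoint_variation (N : nat) (x : nat -> E * M)
    (d : forall k, tangent (x k)) : Prop :=
  let de k : tangent (x k).1 := (d k).1 in
  let dm k : tangent (x k).2 := (d k).2 in
  exists t : forall k, tangent (x k).1,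
    [/\ forall k, (k.+1 < N)%N -> dm k = mdiff phi (x k.+1).1 (de k.+1),
        dm N.-1 = 0,
        de N.-1 = t N.-1,
        forall k, (0 < k)%N -> (k.+1 < N)%N ->
          de k = t k + chaining S (x k) (x k.+1) (t k.+1) &
        de 0%N = chaining S (x 0%N) (x 1%N) (t 1%N)].

(* $S_d$ on $C'(E)^N$, for $N\ge 1$. *)
Definition action_sum (N : nat) (p : power (E * M)%type N.-1) : R :=
  \sum_(k < N) lagrangian S (coord p k).

Definition trajectory (N : nat) (x : nat -> E * M) : Prop :=
  discrete_path N x /\
  forall d : (forall k, tangent (x k)), fixed_endpoint_variation N d ->
    vdiff (@action_sum N) (point N.-1 x) (tpoint N.-1 d) = 0.

Record symmetry_group (G : lieGroupType R) (B : manifoldType R)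
    (lE : G -> E -> E) (lM : G -> M -> M) (rF : G -> F -> F) (piM : M -> B) :
    Prop := {
  symmetry_action : bundle_action phi lE lM rF piM;
  symmetry_lagrangian : forall g x,
    lagrangian S (lE g x.1, lM g x.2) = lagrangian S x;
  symmetry_chaining : forall g x y, composable phi (x, y) ->
    forall u : tangent y.1,
      chaining S (lE g x.1, lM g x.2) (lE g y.1, lM g y.2)
               (mdiff (lE g) y.1 u) =
      mdiff (lE g) x.1 (chaining S x y u) }.

End DLPS.

Section Reduction.
Variables (R : realType) (G : lieGroupType R).

Record discrete_connection (M B : manifoldType R) (lM : G -> M -> M)
    (piM : M -> B) := DiscreteConnection {
  hor : set (M * M);
  connection_map :> M -> M -> G;
  hor_submanifold : submanifold hor;
  hor_invariant : forall g z, hor z -> hor (lM g z.1, lM g z.2);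
  hor_diagonal : forall m, hor (m, m);
  hor_inj : forall z z', hor z -> hor z' ->
    (z.1, piM z.2) = (z'.1, piM z'.2) -> z = z';
  hor_local_diffeo :
    local_diffeo_from hor (fun z : M * M => (z.1, piM z.2));
  hor_onto : forall w : M * B, exists2 z, hor z & (z.1, piM z.2) = w;
  connection_mapP : forall m0 m1 g,
    hor (m0, lM g^-1%g m1) <-> g = connection_map m0 m1;
  connection_smooth :
    smooth (fun z : M * M => connection_map z.1 z.2) }.

Definition conj_action (E : manifoldType R) (lE : G -> E -> E) (g : G)
    (z : E * G) : E * G :=
  (lE g z.1, (g * z.2 * g^-1)%g).

Section Upsilon.
Variables (E M F B GE : manifoldType R) (phi : fiber_bundle E M F).
Variables (lE : G -> E -> E) (lM : G -> M -> M) (piM : M -> B).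
Variables (Ad : discrete_connection lM piM) (q : E * G -> GE).

Definition Upsilon (x : E * M) : GE * B :=
  (q (x.1, Ad (phi x.1) x.2), piM x.2).

(* [q] presents [GE] as $\tilde G_E=(E\times G)/G$, and [p] is its bundle
   projection to $M/G$. In [reduced_chaining], the vector [u] ranges over all
   vectors, hence over all lifts of the argument of the reduced map. *)
Record reduced_system (S : dlps phi) (p : fiber_bundle GE B (F * G)%type)
    (Sred : dlps p) : Prop := {
  reduced_quotient : quotient_map (conj_action lE) q;
  reduced_proj : forall e w, p (q (e, w)) = piM (phi e);
  reduced_lagrangian : forall x,
    lagrangian Sred (Upsilon x) = lagrangian S x;
  reduced_chaining : forall x y, composable phi (x, y) ->
    forall u : tangent y.1,
      chaining Sred (Upsilon x) (Upsilon y) (mdiff1 (z := y) (fst \o Upsilon) u)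
      = mdiff1 (z := x) (fst \o Upsilon) (chaining S x y u) +
        mdiff2 (z := x) (fst \o Upsilon) (mdiff phi y.1 u) }.

End Upsilon.
End Reduction.

(* Main.v *)
Require Import Defs.
From mathcomp Require Import all_boot all_order all_algebra.
From mathcomp Require Import all_classical all_reals topology normedtype landau derive.

(** The discrete action of a path is the reduced action of its image under
    [Upsilon], so it suffices to match variations: those of the path, generated
    by vectors [t k], are sent by the differential of [Upsilon] to those of the
    image, generated by the vectors [D_1 (p_1 o Upsilon) (t k)]. This is where
    the formula for the reduced chaining map enters, together with verticality
    of the original one. Every reduced variation is so obtained because the maps
    [D_1 (p_1 o Upsilon)] are onto: for fixed [m], the quotient map [q] factors
    through [e |-> p_1 (Upsilon (e, m))], and [q] is a submersion. *)

Set Implicit Arguments.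
Unset Strict Implicit.
Unset Printing Implicit Defensive.

Import Order.TTheory GRing.Theory Num.Theory.
Import numFieldNormedType.Exports.
Local Open Scope classical_set_scope.
Local Open Scope ring_scope.

(** A first-order expansion at [x] only sees the germ of the map. Used below for coordinate
    expressions that agree only where chart maps and their inverses cancel. *)
Lemma near_is_diff (K : numFieldType) (V W : normedModType K) (f g df : V -> W)
    (x : V) :
  (\forall y \near x, f y = g y) -> is_diff x f df -> is_diff x g df.
Proof.
move=> fg dfx; have df_f : differentiable f x by [].
have fgx : f x = g x := nbhs_singleton fg.
have [fc /eqaddoP flin] := (diff_locallyP x f).1 df_f.
have fgs : \forall h \near 0, f (h + x) = g (h + x).
  by move: fg; rewrite (near_shift 0) subr0.
have glin : g \o shift x = cst (g x) + 'd f x +o_ 0 id.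
  apply/eqaddoP => e e0; near=> h.
  rewrite -fgx [_ h](_ : _ = (f \o shift x - (cst (f x) + 'd f x)) h).
    by near: h; exact: flin.
  by rewrite !fctE /= (near fgs h).
have dg := diff_unique fc glin.
apply: DiffDef; last by rewrite dg diff_val.
by apply/diff_locallyP; rewrite dg.
Unshelve. all: by end_near. Qed.

(** * Chain rule and basic differentials of maps between manifolds, in preferred charts *)

Section ChartCalculus.
Variable R : realType.
Implicit Types X Y Z : manifoldType R.

(** Continuity is a separate clause: [cmap] is arbitrary outside its domain, so a differentiable
    coordinate expression does not prevent [f] from leaving the chart. *)
Definition mdifferentiable X Y (f : X -> Y) (x : X) : Prop :=
  {for x, continuous f} /\
  differentiable (cmap (chart_at (f x)) \o f \o cinv (chart_at x))
    (cmap (chart_at x) x).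

Definition vdifferentiable X (V : normedModType R) (f : X -> V) (x : X) : Prop :=
  differentiable (f \o cinv (chart_at x)) (cmap (chart_at x) x).

Lemma chart_atK X (x : X) : cinv (chart_at x) (cmap (chart_at x) x) = x.
Proof. by rewrite cmapK//; exact: mem_chart_at. Qed.

Lemma cinv_chart_at_cont X (x : X) :
  {for cmap (chart_at x) x, continuous (cinv (chart_at x))}.
Proof. by apply: cinv_cont; apply: cmap_img; exact: mem_chart_at. Qed.

Lemma Cinfty_differentiable (V W : normedModType R) (U : set V) (f : V -> W) u :
  Cinfty U f -> U u -> differentiable f u.
Proof. by move=> /(_ 1%N) [Df [/(_ u) dfU _]] /dfU []. Qed.

Lemma smooth_mdifferentiable X Y (f : X -> Y) (x : X) :
  smooth f -> mdifferentiable f x.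
Proof.
move=> [fc fs]; split; first exact: fc.
have fC := fs _ _ (atlas_chart_at x) (atlas_chart_at (f x)).
apply: (Cinfty_differentiable fC); split=> /=.
  by apply: cmap_img; exact: mem_chart_at.
by rewrite chart_atK; split=> //; exact: mem_chart_at.
Qed.

Lemma vsmooth_vdifferentiable X (V : normedModType R) (f : X -> V) (x : X) :
  vsmooth f -> vdifferentiable f x.
Proof.
move=> fs; apply: (Cinfty_differentiable (fs _ (atlas_chart_at x))).
by split=> //=; apply: cmap_img; exact: mem_chart_at.
Qed.

Lemma vis_diff_comp X Y (V : normedModType R) (f : X -> Y) (g : Y -> V) (x : X) :
  mdifferentiable f x -> vdifferentiable g (f x) ->
  is_diff (cmap (chart_at x) x) ((g \o f) \o cinv (chart_at x))
    (vdiff g (f x) \o mdiff f x).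
Proof.
move=> [fc fd] gd.
set F := cmap _ \o f \o _ in fd.
have Fx : F (cmap (chart_at x) x) = cmap (chart_at (f x)) (f x).
  by rewrite /F /= chart_atK.
have gdF : is_diff (F (cmap (chart_at x) x)) (g \o cinv (chart_at (f x)))
    (vdiff g (f x)).
  by rewrite Fx; apply: DiffDef.
(* The coordinate expressions compose only where [f] stays in the chart domain at [f x]; continuity
   ensures this near the base point. *)
apply: near_is_diff (is_diff_comp (differentiableP fd) gdF).
have fcinv : {for cmap (chart_at x) x, continuous (f \o cinv (chart_at x))}.
  apply: continuous_comp; first exact: cinv_chart_at_cont.
  by rewrite chart_atK.
have dom_f : nbhs ((f \o cinv (chart_at x)) (cmap (chart_at x) x))
    (cdom (chart_at (f x))).
  rewrite /= chart_atK.
  by apply: open_nbhs_nbhs; split; [exact: open_cdom | exact: mem_chart_at].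
have near_dom : \forall y \near cmap (chart_at x) x,
    cdom (chart_at (f x)) (f (cinv (chart_at x) y)) by exact: fcinv dom_f.
by near=> y; rewrite /F /= cmapK //; near: y.
Unshelve. all: by end_near. Qed.

Lemma vdiff_comp X Y (V : normedModType R) (f : X -> Y) (g : Y -> V) (x : X) u :
  mdifferentiable f x -> vdifferentiable g (f x) ->
  vdiff (g \o f) x u = vdiff g (f x) (mdiff f x u).
Proof. by move=> df /(vis_diff_comp df) d; rewrite /vdiff diff_val. Qed.

Lemma mdifferentiable_comp X Y Z (f : X -> Y) (g : Y -> Z) (x : X) :
  mdifferentiable f x -> mdifferentiable g (f x) -> mdifferentiable (g \o f) x.
Proof.
move=> df [gc gd]; split; first by apply: continuous_comp; [exact: df.1 | ].
(* Composing [g] with the target chart reduces to the vector-valued chain rule. *)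
by have [] := @vis_diff_comp _ _ _ _ (cmap (chart_at (g (f x))) \o g) _ df gd.
Qed.

Lemma mdiff_comp X Y Z (f : X -> Y) (g : Y -> Z) (x : X) u :
  mdifferentiable f x -> mdifferentiable g (f x) ->
  mdiff (g \o f) x u = mdiff g (f x) (mdiff f x u).
Proof.
move=> df [gc gd].
exact: (@vdiff_comp _ _ _ _ (cmap (chart_at (g (f x))) \o g)).
Qed.

Lemma mis_diff_id X (x : X) :
  is_diff (cmap (chart_at x) x) (cmap (chart_at x) \o cinv (chart_at x)) id.
Proof.
have img_nbhs : nbhs (cmap (chart_at x) x) (cimg (chart_at x)).
  apply: open_nbhs_nbhs; split; first exact: open_cimg.
  by apply: cmap_img; exact: mem_chart_at.
apply: near_is_diff (@is_diff_id _ _ (cmap (chart_at x) x)).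
by apply: filterS img_nbhs => y yimg /=; rewrite cinvK.
Qed.

Lemma mdifferentiable_id X (x : X) : mdifferentiable (@id X) x.
Proof. by split; [exact: cvg_id | have [] := mis_diff_id x]. Qed.

Lemma mdiff_id X (x : X) u : mdiff (@id X) x u = u.
Proof. by have d := mis_diff_id x; rewrite /mdiff diff_val. Qed.

Lemma mis_diff_fst X Y (z : X * Y) :
  is_diff (cmap (chart_at z) z) (cmap (chart_at z.1) \o fst \o cinv (chart_at z))
    fst.
Proof.
have fst_cont : continuous (fst : model X * model Y -> model X).
  by move=> u; exact: cvg_fst.
have d1 : is_diff (cmap (chart_at z) z) (fst : model X * model Y -> model X) fst.
  by apply: DiffDef; [exact: linear_differentiable | rewrite diff_lin].
(* The chart at [z] is by definition the product chart, so this is the linear projection followed by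
   the coordinate expression of the identity. *)
exact: (is_diff_comp d1 (mis_diff_id z.1)).
Qed.

Lemma mdifferentiable_fst X Y (z : X * Y) : mdifferentiable (@fst X Y) z.
Proof. by split; [exact: cvg_fst | have [] := mis_diff_fst z]. Qed.

Lemma mdiff_fst X Y (z : X * Y) (u : tangent z) : mdiff (@fst X Y) z u = u.1.
Proof. by have d := mis_diff_fst z; rewrite /mdiff diff_val. Qed.

Lemma mis_diff_snd X Y (z : X * Y) :
  is_diff (cmap (chart_at z) z) (cmap (chart_at z.2) \o snd \o cinv (chart_at z))
    snd.
Proof.
have snd_cont : continuous (snd : model X * model Y -> model Y).
  by move=> u; exact: cvg_snd.
have d2 : is_diff (cmap (chart_at z) z) (snd : model X * model Y -> model Y) snd.
  by apply: DiffDef; [exact: linear_differentiable | rewrite diff_lin].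
exact: (is_diff_comp d2 (mis_diff_id z.2)).
Qed.

Lemma mdifferentiable_snd X Y (z : X * Y) : mdifferentiable (@snd X Y) z.
Proof. by split; [exact: cvg_snd | have [] := mis_diff_snd z]. Qed.

Lemma mdiff_snd X Y (z : X * Y) (u : tangent z) : mdiff (@snd X Y) z u = u.2.
Proof. by have d := mis_diff_snd z; rewrite /mdiff diff_val. Qed.

Lemma mdifferentiable_cst X Y (y : Y) (x : X) :
  mdifferentiable (fun _ : X => y) x.
Proof. by split; [exact: cvg_cst | exact: differentiable_cst]. Qed.

Lemma mdiff_cst X Y (y : Y) (x : X) u : mdiff (fun _ : X => y) x u = 0.
Proof.
by rewrite /mdiff (_ : _ \o _ = cst (cmap (chart_at y) y)) // diff_cst.
Qed.

Lemma mdifferentiable_pair X Y Z (f : X -> Y) (g : X -> Z) (x : X) :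
  mdifferentiable f x -> mdifferentiable g x ->
  mdifferentiable (fun x => (f x, g x)) x.
Proof.
move=> [fc fd] [gc gd]; split; first exact: cvg_pair.
exact: (differentiable_pair fd gd).
Qed.

Lemma mdiff_pair X Y Z (f : X -> Y) (g : X -> Z) (x : X) u :
  mdifferentiable f x -> mdifferentiable g x ->
  mdiff (fun x => (f x, g x)) x u = (mdiff f x u, mdiff g x u).
Proof.
move=> [fc fd] [gc gd]; have d := diff_pair fd gd.
exact: (congr1 (fun h => h u) d).
Qed.

End ChartCalculus.

(** * Partial differentials, and the differential of the discrete action as a sum *)

Section ProductDifferentials.
Variable R : realType.

Lemma mdiff_partial (X Y Z : manifoldType R) (f : X * Y -> Z) (z : X * Y)
    (u : tangent z) :
  mdiff f z u = mdiff1 (z := z) f u.1 + mdiff2 (z := z) f u.2.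
Proof.
rewrite /mdiff1 /mdiff2 -[RHS](linearD (mdiff f z)); congr (mdiff f z _).
by case: u => u v; congr pair; rewrite /= ?addr0 ?add0r.
Qed.

Lemma mdiff1E (X Y Z : manifoldType R) (f : X * Y -> Z) (z : X * Y)
    (u : tangent z.1) :
  mdifferentiable f z -> mdiff1 (z := z) f u = mdiff (fun a => f (a, z.2)) z.1 u.
Proof.
case: z u => a b u fz.
have idd := mdifferentiable_id a; have cstd := mdifferentiable_cst b a.
rewrite (_ : (fun _ => _) = f \o (fun a => (a, b)))//.
rewrite mdiff_comp//; last exact: mdifferentiable_pair.
by rewrite mdiff_pair// mdiff_id mdiff_cst.
Qed.

Lemma mdiff1D (X Y Z : manifoldType R) (f : X * Y -> Z) (z : X * Y)
    (u v : tangent z.1) :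
  mdiff1 (z := z) f (u + v) = mdiff1 (z := z) f u + mdiff1 (z := z) f v.
Proof.
rewrite /mdiff1 -[RHS](linearD (mdiff f z)); congr (mdiff f z _).
by congr pair; rewrite /= addr0.
Qed.

Lemma is_diff_vsum (X Y : manifoldType R) (V : normedModType R)
    (f : X -> V) (g : Y -> V) (z : X * Y) :
  vdifferentiable f z.1 -> vdifferentiable g z.2 ->
  is_diff (cmap (chart_at z) z)
    ((fun z => f z.1 + g z.2) \o cinv (chart_at z))
    (fun u => vdiff f z.1 u.1 + vdiff g z.2 u.2).
Proof.
move=> df dg.
have h1 := vis_diff_comp (mdifferentiable_fst z) df.
have h2 := vis_diff_comp (mdifferentiable_snd z) dg.
have h := is_diffD h1 h2.
apply: DiffDef; first by have [] := h.
have [_ e] := h; rewrite [LHS]e; apply/funext => u /=.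
by rewrite !fctE /= mdiff_fst mdiff_snd.
Qed.

(** Induction on [n], splitting off the first factor. Both claims are proved together because the
    formula for the next power uses differentiability of the tail sum. *)
Lemma is_diff_sum_coord (X : manifoldType R) (V : normedModType R) (f : X -> V)
    (n : nat) (x : nat -> X) :
  (forall k, vdifferentiable f (x k)) ->
  vdifferentiable (fun p : power X n => \sum_(k < n.+1) f (Defs.coord p k))
    (Defs.point n x) /\
  forall d : (forall k, tangent (x k)),
    vdiff (fun p : power X n => \sum_(k < n.+1) f (Defs.coord p k)) (Defs.point n x)
      (tpoint n d) = \sum_(k < n.+1) vdiff f (x k) (d k).
Proof.
elim: n x => [|n IH] x fx.
  rewrite (_ : (fun _ => _) = f); last by apply/funext => p; rewrite big_ord1.
  by split=> [|d]; [exact: fx | rewrite big_ord1].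
have [sd sdE] := IH (fun k => x k.+1) (fun k => fx k.+1).
rewrite (_ : (fun _ => _) = fun p : power X n.+1 =>
    f p.1 + \sum_(k < n.+1) f (Defs.coord p.2 k)); last first.
  by apply/funext => p; rewrite big_ord_recl.
have h := @is_diff_vsum X (power X n) V f _ (Defs.point n.+1 x) (fx 0%N) sd.
split=> [|d]; first by have [] := h.
have [_ e] := h; rewrite /vdiff [in LHS]e /=.
by rewrite big_ord_recl; congr (_ + _); exact: sdE.
Qed.

Lemma vdiff_action_sum (E M F : manifoldType R) (phi : fiber_bundle E M F)
    (S : dlps phi) (N : nat) (x : nat -> E * M)
    (d : forall k, tangent (x k)) :
  (0 < N)%N ->
  vdiff (@action_sum _ _ _ _ _ S N) (Defs.point N.-1 x) (tpoint N.-1 d) =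
  \sum_(k < N) vdiff (lagrangian S) (x k) (d k).
Proof.
case: N => // n _; apply: (is_diff_sum_coord _ _).2 => k.
exact: vsmooth_vdifferentiable (lagrangian_smooth S).
Qed.

End ProductDifferentials.

Lemma last_index (N k : nat) : (k < N)%N -> (N <= k.+1)%N -> k = N.-1.
Proof. by move=> kN Nk; rewrite (@anti_leq N k.+1) ?Nk. Qed.

(** * Fixed-endpoint variations and their generating vectors *)

Section Variations.
Variables (R : realType) (E M F : manifoldType R) (phi : fiber_bundle E M F).
Variable S : dlps phi.

(** The clauses of [fixed_endpoint_variation] with the generators [t] exposed, so that variations
    can be compared through them. *)
Definition variation_via (N : nat) (x : nat -> E * M)
    (t : forall k, tangent (x k).1) (d : forall k, tangent (x k)) : Prop :=
  [/\ forall k, (k.+1 < N)%N ->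
        (d k).2 = mdiff phi (x k.+1).1 (d k.+1).1 :> tangent (x k).2,
      (d N.-1).2 = 0 :> tangent (x N.-1).2,
      (d N.-1).1 = t N.-1,
      forall k, (0 < k)%N -> (k.+1 < N)%N ->
        (d k).1 = t k + chaining S (x k) (x k.+1) (t k.+1) &
      (d 0%N).1 = chaining S (x 0%N) (x 1%N) (t 1%N)].

Lemma variation_viaP (N : nat) (x : nat -> E * M) (d : forall k, tangent (x k)) :
  fixed_endpoint_variation S N d <-> exists t, variation_via N t d.
Proof. by []. Qed.

Lemma variation_via_exists (N : nat) (x : nat -> E * M)
    (t : forall k, tangent (x k).1) :
  (2 <= N)%N -> exists d, variation_via N t d.
Proof.
move=> N2.
(* The tests drop the terms absent at the ends: the generator at index 0 and the chaining term at
   index [N.-1]. *)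
pose de k : tangent (x k).1 := (if (0 < k)%N then t k else 0) +
  (if (k.+1 < N)%N then chaining S (x k) (x k.+1) (t k.+1) else 0).
pose dm k : tangent (x k).2 :=
  if (k.+1 < N)%N then mdiff phi (x k.+1).1 (de k.+1) else 0.
exists (fun k => (de k, dm k)).
have NK : N.-1.+1 = N by case: N N2 {de dm}.
(* Since [2 <= N], the clauses for the first and the last index do not collide. *)
have N1 : (0 < N.-1)%N by rewrite -ltnS NK.
split=> [k kN|||k k0 kN|] /=.
- by rewrite /dm kN.
- by rewrite /dm NK ltnn.
- by rewrite /de NK ltnn N1 addr0.
- by rewrite /de k0 kN.
- by rewrite /de N2 add0r.
Qed.

(** The generators prescribe the components in [E] at the first, inner and last indices, and these
    determine the components in [M]. Nothing is prescribed from [N] on. *)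
Lemma variation_via_inj (N : nat) (x : nat -> E * M)
    (t : forall k, tangent (x k).1) (d d' : forall k, tangent (x k)) :
  variation_via N t d -> variation_via N t d' ->
  forall k, (k < N)%N -> d k = d' k.
Proof.
move=> [d1 d2 d3 d4 d5] [e1 e2 e3 e4 e5].
have fst_eq k : (k < N)%N -> (d k).1 = (d' k).1.
  move=> kN; have [kN1|] := ltnP k.+1 N; last first.
    by move=> Nk; rewrite (last_index kN Nk) d3 e3.
  by case: k kN kN1 => [|k] kN kN1; [rewrite d5 e5 | rewrite d4// e4].
move=> k kN; rewrite [d k]surjective_pairing [d' k]surjective_pairing.
congr pair; first exact: fst_eq.
have [kN1|] := ltnP k.+1 N; first by rewrite d1// e1// fst_eq.
by move=> Nk; rewrite (last_index kN Nk) d2 e2.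
Qed.

(* Verticality of the chaining map lets the generator replace the variation. *)
Lemma variation_via_snd (N : nat) (x : nat -> E * M)
    (t : forall k, tangent (x k).1) (d : forall k, tangent (x k)) (k : nat) :
  discrete_path phi N x -> variation_via N t d -> (k.+1 < N)%N ->
  (d k).2 = mdiff phi (x k.+1).1 (t k.+1).
Proof.
move=> hx [d1 d2 d3 d4 d5] kN; rewrite d1//.
have [kN1|] := ltnP k.+2 N; last first.
  by move=> Nk; rewrite (last_index kN Nk) d3.
by rewrite d4// linearD chaining_vertical ?addr0//; exact: hx.
Qed.

End Variations.

(** * Differential of [Upsilon] and surjectivity of its first partial *)

Section UpsilonDifferential.
Variables (R : realType) (G : lieGroupType R) (E M F B GE : manifoldType R).
Variables (phi : fiber_bundle E M F) (lE : G -> E -> E) (lM : G -> M -> M).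
Variables (piM : M -> B) (Ad : discrete_connection lM piM) (q : E * G -> GE).
Hypothesis actM : left_action lM.
Hypothesis actE : left_action lE.
Hypothesis phi_equiv : forall g e, phi (lE g e) = lM g (phi e).
Hypothesis piM_smooth : smooth piM.
Hypothesis q_quot : quotient_map (conj_action lE) q.

Let Ups := Upsilon phi Ad q.

(** Translating the horizontal pair over [(m0, m1)] diagonally by [g] gives a horizontal pair
    starting at [lM g m0]; uniqueness of the group element does the rest. *)
Lemma connection_mapM (g : G) (m0 m1 : M) :
  Ad (lM g m0) m1 = (Ad m0 m1 * g^-1)%g.
Proof.
apply/esym/connection_mapP; rewrite invgM invgK (left_actionM actM).
apply: (@hor_invariant _ _ _ _ _ _ Ad g (m0, _)).
exact/connection_mapP.
Qed.

Lemma mdifferentiable_connection (x : E * M) :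
  mdifferentiable (fun x : E * M => Ad (phi x.1) x.2) x.
Proof.
apply: (@mdifferentiable_comp _ _ _ _ (fun x : E * M => (phi x.1, x.2))
  (fun z => Ad z.1 z.2)); last exact: smooth_mdifferentiable (connection_smooth Ad).
apply: mdifferentiable_pair; last exact: mdifferentiable_snd.
apply: (@mdifferentiable_comp _ _ _ _ fst phi x).
  exact: mdifferentiable_fst.
exact: smooth_mdifferentiable (bundle_smooth phi).
Qed.

Lemma mdifferentiable_Upsilon1 (x : E * M) : mdifferentiable (fst \o Ups) x.
Proof.
apply: (@mdifferentiable_comp _ _ _ _
  (fun x : E * M => (x.1, Ad (phi x.1) x.2)) q).
  apply: mdifferentiable_pair; first exact: mdifferentiable_fst.
  exact: mdifferentiable_connection.
exact: smooth_mdifferentiable (quotient_smooth q_quot).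
Qed.

Lemma mdifferentiable_piM_snd (x : E * M) :
  mdifferentiable (piM \o snd : E * M -> B) x.
Proof.
apply: mdifferentiable_comp; first exact: mdifferentiable_snd.
exact: smooth_mdifferentiable.
Qed.

Lemma mdifferentiable_Upsilon (x : E * M) : mdifferentiable Ups x.
Proof.
exact: mdifferentiable_pair (mdifferentiable_Upsilon1 x)
  (mdifferentiable_piM_snd x).
Qed.

Lemma mdiff_Upsilon (x : E * M) (u : tangent x) :
  mdiff Ups x u =
  (mdiff (fst \o Ups) x u, mdiff piM x.2 u.2) :> (model GE * model B)%type.
Proof.
have h := mdiff_pair u (mdifferentiable_Upsilon1 x) (mdifferentiable_piM_snd x).
rewrite [LHS]h; congr pair; rewrite mdiff_comp.
- by rewrite mdiff_snd.
- exact: mdifferentiable_snd.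
- exact: smooth_mdifferentiable.
Qed.

(* Each orbit of [E * G] meets the graph of [e |-> Ad (phi e) m] exactly once;
   [slide m] is the first component of the resulting retraction. *)
Definition slide (m : M) (z : E * G) : E :=
  lE (Ad (phi z.1) m * z.2^-1)%g z.1.

Lemma slideE (m : M) (z : E * G) : q z = (Ups (slide m z, m)).1.
Proof.
case: z => e w; apply/(quotient_fiber q_quot).
(* Conjugating [w] by this element [g] gives [Ad (phi e) m * g^-1], which is the connection at the
   moved point by [connection_mapM]. *)
exists (Ad (phi e) m * w^-1)%g; rewrite /conj_action /slide /=.
by rewrite phi_equiv connection_mapM mulgVK.
Qed.

Lemma slide_id (e : E) (m : M) : slide m (e, Ad (phi e) m) = e.
Proof. by rewrite /slide /= mulgV (left_action1 actE). Qed.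

Lemma mdifferentiable_slide (m : M) (z : E * G) : mdifferentiable (slide m) z.
Proof.
have fstd := mdifferentiable_fst z; have sndd := mdifferentiable_snd z.
have Add : mdifferentiable (fun z : E * G => Ad (phi z.1) m) z.
  apply: (@mdifferentiable_comp _ _ _ _ (fun z : E * G => (z.1, m))
    (fun x => Ad (phi x.1) x.2)); last exact: mdifferentiable_connection.
  by apply: mdifferentiable_pair => //; exact: mdifferentiable_cst.
have invd : mdifferentiable (fun z : E * G => z.2^-1)%g z.
  apply: (@mdifferentiable_comp _ _ _ _ snd (fun g : G => g^-1)%g) => //.
  exact: smooth_mdifferentiable invg_smooth.
apply: (@mdifferentiable_comp _ _ _ _
  (fun z : E * G => (Ad (phi z.1) m * z.2^-1, z.1)%g)
  (fun p : G * E => lE p.1 p.2)).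
  apply: mdifferentiable_pair => //.
  apply: (@mdifferentiable_comp _ _ _ _
    (fun z : E * G => (Ad (phi z.1) m, z.2^-1)%g)
    (fun p : G * G => p.1 * p.2)%g); first exact: mdifferentiable_pair.
  exact: smooth_mdifferentiable mulg_smooth.
exact: smooth_mdifferentiable (left_action_smooth actE).
Qed.

Lemma mdiff1_Upsilon1_surj (x : E * M) (v : tangent (Ups x).1) :
  exists u : tangent x.1, mdiff1 (z := x) (fst \o Ups) u = v.
Proof.
case: x v => e m v.
(* The graph point over [e]: [q z] is the first component of [Upsilon] at [(e, m)], so [v] lifts
   through [q] at [z]. *)
set z := (e, Ad (phi e) m).
have [a qa] := quotient_submersion q_quot (x := z) v.
exists (mdiff (slide m) z a).
have Ud := mdifferentiable_Upsilon1 (e, m).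
have slice_d : mdifferentiable (fun e => (e, m)) e.
  by apply: mdifferentiable_pair; [exact: mdifferentiable_id |
    exact: mdifferentiable_cst].
pose Um (e : E) := (Ups (e, m)).1.
have Umd : mdifferentiable Um (slide m z).
  rewrite slide_id.
  exact: (@mdifferentiable_comp _ _ _ _ (fun e => (e, m)) (fst \o Ups)).
have qE : q = Um \o slide m by apply/funext => y; exact: slideE.
(* Differentiating the factorization of [q] shows that the slid lift maps to [v]; [slide_id] returns
   the base point to [e]. *)
have : mdiff (Um \o slide m) z a = v :> model GE by rewrite -qE.
rewrite mdiff_comp //; last exact: mdifferentiable_slide.
by rewrite mdiff1E // slide_id.
Qed.

End UpsilonDifferential.

(** * Correspondence of variations and of action differentials under [Upsilon] *)

Section ReductionOfVariations.
Variables (R : realType) (G : lieGroupType R) (E M F B GE : manifoldType R).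
Variables (phi : fiber_bundle E M F) (S : dlps phi).
Variables (lE : G -> E -> E) (lM : G -> M -> M) (piM : M -> B).
Variables (Ad : discrete_connection lM piM) (q : E * G -> GE).
Variables (p : fiber_bundle GE B (F * G)%type) (Sred : dlps p).
Hypothesis piM_smooth : smooth piM.
Hypothesis hred : reduced_system lE Ad q S Sred.

Let Ups := Upsilon phi Ad q.

Let q_quot : quotient_map (conj_action lE) q := reduced_quotient hred.

(** Differentiate [p \o (fst \o Ups) = piM \o (phi \o fst)]; composability identifies [x.2] with
    [phi y.1]. This yields the matching clause of reduced variations. *)
Lemma mdiff_proj_Upsilon1 (x y : E * M) (u : tangent y) :
  composable phi (x, y) ->
  mdiff p (Ups y).1 (mdiff (fst \o Ups) y u) =
  mdiff piM x.2 (mdiff phi y.1 u.1) :> model B.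
Proof.
case: x => e m; rewrite /composable /= => ->.
have pd z : mdifferentiable p z := smooth_mdifferentiable z (bundle_smooth p).
have phid z : mdifferentiable phi z :=
  smooth_mdifferentiable z (bundle_smooth phi).
have piMd z : mdifferentiable piM z := smooth_mdifferentiable z piM_smooth.
have Ud := mdifferentiable_Upsilon1 phi Ad q_quot y.
have fstd := mdifferentiable_fst y.
have eq_proj : p \o (fst \o Ups) = piM \o (phi \o fst).
  by apply/funext => z; rewrite /= (reduced_proj hred).
rewrite -(mdiff_comp u Ud (pd _)) eq_proj mdiff_comp//; last first.
  exact: mdifferentiable_comp.
by rewrite [X in mdiff piM _ X]mdiff_comp// mdiff_fst.
Qed.

(** Splitting into partial differentials, the terms in [u] are exactly the formula for the reduced
    chaining map. *)
Lemma mdiff_Upsilon1_chaining (x y : E * M) (t : tangent x.1) (u : tangent y.1) :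
  composable phi (x, y) ->
  mdiff (fst \o Ups) x (t + chaining S x y u, mdiff phi y.1 u) =
  mdiff1 (z := x) (fst \o Ups) t +
  chaining Sred (Ups x) (Ups y) (mdiff1 (z := y) (fst \o Ups) u).
Proof.
move=> xy; rewrite (reduced_chaining hred xy) mdiff_partial /= mdiff1D.
by rewrite addrA.
Qed.

Lemma discrete_path_Upsilon (N : nat) (x : nat -> E * M) :
  discrete_path phi N x -> discrete_path p N (fun k => Ups (x k)).
Proof.
move=> hx k kN; rewrite /composable /= (reduced_proj hred).
by congr piM; exact: hx.
Qed.

(** [t'] is kept apart from the images of [t] because one direction of the theorem starts from
    reduced generators and the other from original ones. *)
Lemma variation_via_Upsilon (N : nat) (x : nat -> E * M)
    (t : forall k, tangent (x k).1) (t' : forall k, tangent (Ups (x k)).1)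
    (d : forall k, tangent (x k)) :
  (2 <= N)%N -> discrete_path phi N x ->
  (forall k, mdiff1 (z := x k) (fst \o Ups) (t k) = t' k) ->
  variation_via S N t d ->
  variation_via (x := fun k => Ups (x k)) Sred N t' (fun k => mdiff Ups (x k) (d k)).
Proof.
move=> N2 hx tt' dt; have dphi k := variation_via_snd hx dt (k := k).
have [d1 d2 d3 d4 d5] := dt.
have UE k := mdiff_Upsilon phi Ad piM_smooth q_quot (d k).
split=> [k kN|||k k0 kN|] /=; rewrite !UE /=.
- by rewrite (mdiff_proj_Upsilon1 _ (hx _ kN)) d1.
- by rewrite d2 linear0.
- by rewrite mdiff_partial d2 d3 -tt' /mdiff2 linear0 addr0.
- rewrite -!tt' -mdiff_Upsilon1_chaining; last exact: hx.
  by rewrite [d k]surjective_pairing d4// dphi.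
(* Index 0 has no generator: insert the image of zero to reach the form with [t = 0]. *)
- rewrite -!tt' -[RHS]add0r -[X in X + _](linear0 (mdiff (fst \o Ups) (x 0%N))).
  rewrite -mdiff_Upsilon1_chaining; last exact: hx.
  by rewrite [d 0%N]surjective_pairing d5 add0r dphi.
Qed.

(** Chain rule in each summand, as the Lagrangian factors through [Upsilon]. Agreement below [N] is
    all the sum sees and all [variation_via_inj] provides. *)
Lemma vdiff_action_sum_Upsilon (N : nat) (x : nat -> E * M)
    (d : forall k, tangent (x k)) (d' : forall k, tangent (Ups (x k))) :
  (0 < N)%N -> (forall k, (k < N)%N -> mdiff Ups (x k) (d k) = d' k) ->
  vdiff (@action_sum _ _ _ _ _ Sred N) (Defs.point N.-1 (fun k => Ups (x k)))
    (tpoint N.-1 d') =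
  vdiff (@action_sum _ _ _ _ _ S N) (Defs.point N.-1 x) (tpoint N.-1 d).
Proof.
move=> N0 dd'; rewrite !vdiff_action_sum//; apply: eq_bigr => k _ /=.
have -> : lagrangian S = lagrangian Sred \o Ups.
  by apply/funext => z; rewrite /= (reduced_lagrangian hred).
rewrite -dd'//; apply/esym/vdiff_comp.
  exact: mdifferentiable_Upsilon piM_smooth q_quot _.
exact: vsmooth_vdifferentiable (lagrangian_smooth Sred).
Qed.

End ReductionOfVariations.

Theorem theorem5p15 (R : realType) (G : lieGroupType R)
  (E M F B GE : manifoldType R)
  (phi : fiber_bundle E M F) (S : dlps phi)
  (lE : G -> E -> E) (lM : G -> M -> M) (rF : G -> F -> F) (piM : M -> B)
  (hG : symmetry_group S lE lM rF piM)
  (Ad : discrete_connection lM piM)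
  (q : E * G -> GE) (p : fiber_bundle GE B (F * G)%type) (Sred : dlps p)
  (hred : reduced_system lE Ad q S Sred)
  (N : nat) (hN : (2 <= N)%N) (x : nat -> E * M)
  (hx : discrete_path phi N x) :
  trajectory S N x <-> trajectory Sred N (fun k => Upsilon phi Ad q (x k)).
Proof.
have [actE _ actM _ _ [_ _ quotM] phi_equiv _] := symmetry_action hG.
have piM_smooth := quotient_smooth quotM.
have N0 : (0 < N)%N := ltnW hN.
split=> -[_ traj].
- split; first exact: (discrete_path_Upsilon hred hx).
  move=> d' /variation_viaP[t' dt'].
  (* Lift each reduced generator separately, then build a variation upstairs from the lifts. *)
  have lift k := mdiff1_Upsilon1_surj actM actE phi_equiv
    (reduced_quotient hred) (x := x k) (t' k).
  pose t k := sval (cid (lift k)).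
  have tt' k := svalP (cid (lift k)).
  have [d dt] := variation_via_exists S t hN.
  (* The image of [d] and the given [d'] have the same generators [t'], hence agree below [N]. *)
  have d'E := variation_via_inj
    (variation_via_Upsilon piM_smooth hred hN hx tt' dt) dt'.
  rewrite (vdiff_action_sum_Upsilon piM_smooth hred N0 d'E).
  by apply: traj; exists t.
(* Conversely, the image of a variation is itself a reduced variation, so no lifting occurs. *)
- split=> // d [t dt].
  have dt' := variation_via_Upsilon piM_smooth hred hN hx (fun=> erefl) dt.
  rewrite -(vdiff_action_sum_Upsilon piM_smooth hred N0 (fun _ _ => erefl)).
  by apply: traj; apply/variation_viaP; eexists; exact: dt'.
Qed.
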